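(* Let $n,m\in\mathbb{N}$, and let $\mathbf p=(p_1,\dots,p_m)\in[0,1]^m$ and $\mathbf p'=(p'_1,\dots,p'_m)\in[0,1]^m$ be such that $\mathbf p\succ\mathbf p'$ (i.e. $\mathbf p$ majorizes $\mathbf p'$). Then $$\sum_{i=1}^m(B_nf)(p_i)\geq \sum_{i=1}^m(B_nf)(p'_i)$$ for all convex functions $f:[0,1]\to\mathbb{R}$.
   Context: $\mathbb{N}$ denotes the positive integers. For $n\in\mathbb{N}$, the Bernstein basic polynomials are $p_{n,i}(x)=\binom{n}{i}x^i(1-x)^{n-i}$ for $i=0,1,\dots,n$, $x\in[0,1]$ (with $0^0=1$). For $f:[0,1]\to\mathbb{R}$, the Bernstein operator is given by $(B_nf)(x)=\sum_{i=0}^n p_{n,i}(x)f\left(\frac in\right)$ for $x\in[0,1]$. Majorization: for $\mathbf p=(p_1,\dots,p_m),\mathbf q=(q_1,\dots,q_m)\in\mathbb{R}^m$, one says that $\mathbf q$ majorizes $\mathbf p$ (written $\mathbf p\prec\mathbf q$ or $\mathbf q\succ\mathbf p$) if (i) $\sum_{l=1}^m\widehat p_l=\sum_{l=1}^m\widehat q_l$ and (ii) $\sum_{l=1}^k\widehat p_l\leq\sum_{l=1}^k\widehat q_l$ for $k=1,\dots,m$, where $\widehat p_1\geq\dots\geq\widehat p_m$ and $\widehat q_1\geq\dots\geq\widehat q_m$ are the nonincreasing rearrangements of $\mathbf p$ and $\mathbf q$, respectively. *)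

(* Defs.v *)
From HB Require Import structures.
From mathcomp Require Import all_boot all_order all_algebra.
From mathcomp Require Import all_classical all_reals all_analysis.
Set Implicit Arguments.
Unset Strict Implicit.
Unset Printing Implicit Defensive.
Import Order.TTheory GRing.Theory Num.Theory.
Import numFieldNormedType.Exports.
Local Open Scope ring_scope.

Definition bernstein_poly (R : realType) (n i : nat) (x : R) : R :=
  'C(n, i)%:R * x ^+ i * (1 - x) ^+ (n - i).

(* A function on [0, 1] is represented by a function on R; the operator only
   uses its values at the nodes i / n, which lie in [0, 1] (for 0 < n). *)
Definition bernstein (R : realType) (n : nat) (f : R -> R) (x : R) : R :=
  \sum_(i < n.+1) bernstein_poly n i x * f (i%:R / n%:R).

Definition rearrange (R : realType) (m : nat) (p : m.-tuple R) : m.-tuple R :=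
  sort_tuple >=%R p.

(* Positions are numbered from 0, so l < k selects the k largest entries. *)
Definition majorizes (R : realType) (m : nat) (q p : m.-tuple R) : Prop :=
  \sum_(l < m) tnth (rearrange p) l = \sum_(l < m) tnth (rearrange q) l /\
  forall k : nat, (1 <= k <= m)%N ->
    \sum_(l < m | (l < k)%N) tnth (rearrange p) l <=
    \sum_(l < m | (l < k)%N) tnth (rearrange q) l.

(* Main.v *)
(** The function [B_n f] is again convex on [[0, 1]]: by the de Casteljau
    recursion, the Bernstein form of a convex coefficient sequence lies above
    its tangents, whose slopes are Bernstein forms of the nondecreasing
    sequence of first differences and are therefore nondecreasing.  Summing the
    tangent inequalities at the sorted entries of [p'] and applying Abel
    summation to the slopes and the partial sums of [p - p'] (both sorted)
    yields Karamata's inequality. *)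
Require Import Defs.
From mathcomp Require Import all_boot all_order all_algebra.
From mathcomp Require Import all_classical all_reals all_analysis.
From mathcomp Require Import ring lra.
Import Order.TTheory GRing.Theory Num.Theory.
Import numFieldNormedType.Exports.
Local Open Scope classical_set_scope.
Local Open Scope ring_scope.

Section BernsteinForm.
Context {R : realType}.
Implicit Types (c d : nat -> R) (x y : R).

(** Coefficients form a sequence on all of [nat], so that shifts and differences of [c] are again
    coefficient sequences and the inductions on the degree can pass to them. *)
Definition bernstein_form c (n : nat) x : R :=
  \sum_(i < n.+1) bernstein_poly n i x * c i.

Lemma bernstein_form0 c x : bernstein_form c 0 x = c 0.
Proof.
by rewrite /bernstein_form big_ord1 /bernstein_poly bin0 subnn !expr0 !mul1r.
Qed.

Lemma bernstein_polyS n i x : (i <= n)%N ->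
  bernstein_poly n.+1 i.+1 x =
  x * bernstein_poly n i x + (1 - x) * bernstein_poly n i.+1 x.
Proof.
move=> le_in; rewrite /bernstein_poly binS natrD subSS exprS.
(* For [i = n] the exponent [n - i.+1] is truncated, but its binomial coefficient vanishes;
   otherwise this is Pascal's rule. *)
have [lt_in|ge_in] := ltnP i n; last by rewrite (bin_small (n := n)) //; ring.
by rewrite -(subnSK lt_in) exprS; ring.
Qed.

Lemma bernstein_form_rec c n x :
  bernstein_form c n.+1 x =
  (1 - x) * bernstein_form c n x
  + x * bernstein_form (fun i => c i.+1) n x.
Proof.
(* Padding with the zero term of index [n.+1] gives both sides the same range; the terms of index 0
   are then compared separately. *)
have -> : bernstein_form c n x = \sum_(i < n.+2) bernstein_poly n i x * c i.
  rewrite big_ord_recr /= [X in _ + X](_ : _ = 0) ?addr0 //.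
  by rewrite /bernstein_poly bin_small // !mul0r.
rewrite /bernstein_form big_ord_recl [in RHS]big_ord_recl mulrDr -addrA.
congr (_ + _).
  by rewrite /bernstein_poly !bin0 !subn0 /= exprS; ring.
rewrite !mulr_sumr -big_split /=; apply: eq_bigr => i _.
by rewrite /bump add1n bernstein_polyS -1?ltnS //; ring.
Qed.

Lemma bernstein_formB c d n x :
  bernstein_form (fun i => c i - d i) n x =
  bernstein_form c n x - bernstein_form d n x.
Proof.
by rewrite /bernstein_form -sumrB; apply: eq_bigr => i _; rewrite mulrBr.
Qed.

Lemma bernstein_form_ge0 c n x : 0 <= x <= 1 ->
  (forall i, (i <= n)%N -> 0 <= c i) -> 0 <= bernstein_form c n x.
Proof.
move=> /andP[x0 x1] c0; apply: sumr_ge0 => i _.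
by rewrite !mulr_ge0 ?exprn_ge0 ?subr_ge0 ?c0 // -ltnS.
Qed.

(** With A and S the degree [n] forms of [c] and of its shift, the increment in degree [n.+1] is (1
    - y)(A(y) - A(x)) + y(S(y) - S(x)) + (y - x)(S(x) - A(x)), and S - A is the form of the first
    differences. *)
Lemma bernstein_form_nondecreasing c n x y :
    (forall i, (i < n)%N -> c i <= c i.+1) ->
    0 <= x -> x <= y -> y <= 1 ->
  bernstein_form c n x <= bernstein_form c n y.
Proof.
elim: n c => [|n IHn] c c_homo x0 xy y1; first by rewrite !bernstein_form0.
rewrite !bernstein_form_rec.
have lec := IHn c (fun i lt_in => c_homo i (ltnW lt_in)) x0 xy y1.
have leS := IHn (fun i => c i.+1) (fun i lt_in => c_homo i.+1 lt_in) x0 xy y1.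
have : 0 <= bernstein_form (fun i => c i.+1 - c i) n x.
  apply: bernstein_form_ge0; first by lra.
  by move=> i le_in; rewrite subr_ge0 c_homo.
by rewrite bernstein_formB; nra.
Qed.

(** The slope on the left is the derivative at [x] of the form of degree [n.+1]. In the induction,
    the gap above the tangent is the (1 - y, y) combination of the gaps for [c] and its shift, plus
    a multiple of (y - x)^2 whose factor is a form of second differences. *)
Lemma bernstein_form_tangent c n x y :
    (forall i, (i < n)%N -> c i.+1 - c i <= c i.+2 - c i.+1) ->
    0 <= x <= 1 -> 0 <= y <= 1 ->
  n.+1%:R * bernstein_form (fun i => c i.+1 - c i) n x * (y - x) <=
  bernstein_form c n.+1 y - bernstein_form c n.+1 x.
Proof.
move=> c_cvx x01 y01; elim: n c c_cvx => [|n IHn] c c_cvx.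
  by rewrite !bernstein_form_rec !bernstein_form0; lra.
pose dc i := c i.+1 - c i.
have tc := IHn c (fun i lt_in => c_cvx i (ltnW lt_in)).
have tS := IHn (fun i => c i.+1) (fun i lt_in => c_cvx i.+1 lt_in).
have : 0 <= bernstein_form (fun i => dc i.+1 - dc i) n x.
  by apply: bernstein_form_ge0 => // i le_in; rewrite subr_ge0 c_cvx.
rewrite bernstein_formB.
have slopeE : bernstein_form dc n.+1 x =
    bernstein_form (fun i => c i.+1) n.+1 x - bernstein_form c n.+1 x.
  by rewrite -bernstein_formB.
have slope_rec := bernstein_form_rec dc n x.
rewrite (bernstein_form_rec c n.+1 x) (bernstein_form_rec c n.+1 y).
rewrite -[n.+2]addn1 natrD.
set N := n.+1%:R; have N0 : 0 <= N by rewrite ler0n.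
move: tc tS slopeE slope_rec; rewrite -/dc -/N.
rewrite -[fun i => c i.+2 - c i.+1]/(fun i => dc i.+1).
set D := bernstein_form dc n.+1 x.
set A' := bernstein_form dc n x.
set S' := bernstein_form (fun i => dc i.+1) n x.
set Ax := bernstein_form c n.+1 x; set Ay := bernstein_form c n.+1 y.
set Sx := bernstein_form _ n.+1 x; set Sy := bernstein_form _ n.+1 y.
move=> tA tS DE Drec A'S'.
have /andP[y0 y1] := y01.
have h1 : 0 <= (1 - y) * (Ay - Ax - N * A' * (y - x)).
  by rewrite mulr_ge0 ?subr_ge0.
have h2 : 0 <= y * (Sy - Sx - N * S' * (y - x)) by rewrite mulr_ge0 ?subr_ge0.
have h3 : 0 <= N * (S' - A') * (y - x) ^+ 2.
  by apply: mulr_ge0 (sqr_ge0 _); exact: mulr_ge0.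
rewrite -subr_ge0.
rewrite (_ : _ - _ = (1 - y) * (Ay - Ax - N * A' * (y - x))
  + y * (Sy - Sx - N * S' * (y - x)) + N * (S' - A') * (y - x) ^+ 2).
  by rewrite !addr_ge0.
(* [N] copies of [D] are expanded by the de Casteljau recursion; the remaining one is the difference
   of the two forms of degree [n.+1]. *)
have -> : (N + 1) * D = N * ((1 - x) * A' + x * S') + (Sx - Ax).
  by rewrite -Drec -DE; ring.
by ring.
Qed.

End BernsteinForm.

Lemma convex_function_nodes {R : realType} (f : R -> R) n i : (i.+1 < n)%N ->
    convex_function (`[0, 1]%classic : set R^o) f ->
  f (i.+1%:R / n%:R) - f (i%:R / n%:R) <=
  f (i.+2%:R / n%:R) - f (i.+1%:R / n%:R).
Proof.
move=> lt_in hf.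
have n0 : 0 < n%:R :> R by rewrite ltr0n; case: n lt_in.
have node01 j : (j <= n)%N -> (j%:R / n%:R : R) \in (`[0, 1]%classic : set R^o).
  move=> le_jn; rewrite inE /= in_itv /= divr_ge0 ?ler0n //=.
  by rewrite ler_pdivrMr // mul1r ler_nat.
have half_ge0 : 0 <= 2^-1 :> R by lra.
have half_le1 : 2^-1 <= 1 :> R by lra.
(* The middle node is the midpoint of its two neighbours. *)
have mid : f (i.+1%:R / n%:R) <=
    2^-1 * f (i%:R / n%:R) + (1 - 2^-1) * f (i.+2%:R / n%:R).
  have -> : i.+1%:R / n%:R =
      2^-1 * (i%:R / n%:R) + (1 - 2^-1) * (i.+2%:R / n%:R) :> R.
    by rewrite -(addn2 i) -(addn1 i) !natrD; field; rewrite lt0r_neq0.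
  exact: (hf (Itv01 half_ge0 half_le1) _ _
    (node01 i (ltnW (ltnW lt_in))) (node01 i.+2 lt_in)).
by lra.
Qed.

(** Abel summation as an induction: lowering the common weight of a nonnegative partial sum from
    [w m] to [w m.+1] can only decrease the product. *)
Lemma abel_sum_ge {R : numDomainType} (w d : nat -> R) m :
    (forall i, (i < m)%N -> w i.+1 <= w i) ->
    (forall k, (k <= m)%N -> 0 <= \sum_(i < k) d i) ->
  w m * \sum_(i < m.+1) d i <= \sum_(i < m.+1) w i * d i.
Proof.
elim: m => [|m IHm] w_homo d_ge0; first by rewrite !big_ord1.
rewrite big_ord_recr [leRHS]big_ord_recr /= mulrDr lerD2r.
apply: le_trans (IHm _ _) => [|i lt_im|k le_km].
- by rewrite ler_wpM2r ?d_ge0 ?w_homo.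
- by rewrite w_homo // ltnW.
- by rewrite d_ge0 // ltnW.
Qed.

Lemma sum_rearrange {R : realType} m (p : m.-tuple R) (g : R -> R) :
  \sum_(i < m) g (tnth (rearrange p) i) = \sum_(i < m) g (tnth p i).
Proof.
rewrite -!(big_tuple _ _ _ xpredT g).
by apply: perm_big; rewrite perm_sort.
Qed.

Lemma rearrange_homo {R : realType} m (p : m.-tuple R) i j :
  (i <= j < m)%N -> (rearrange p)`_j <= (rearrange p)`_i.
Proof.
move=> /andP[le_ij lt_jm].
have ge_total : total (>=%R : rel R) by move=> x y; exact: le_total.
have ge_tr : transitive (>=%R : rel R) by move=> x y z /[swap]; exact: le_trans.
apply: (sorted_leq_nth ge_tr (@lexx _ R) 0 (sort_sorted ge_total p)) => //.
  by rewrite inE size_sort size_tuple (leq_ltn_trans le_ij).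
by rewrite inE size_sort size_tuple.
Qed.

Lemma majorizes_partial_sum {R : realType} m (q p : m.-tuple R) k :
  majorizes q p -> (k <= m)%N ->
  0 <= \sum_(i < k) ((rearrange q)`_i - (rearrange p)`_i).
Proof.
(* [majorizes] speaks of [k] from 1 on; Abel summation also uses the empty sum. *)
move=> [_ q_ge]; case: k => [|k] le_km; first by rewrite big_ord0.
have nthE (r : m.-tuple R) : \sum_(l < m | (l < k.+1)%N) tnth (rearrange r) l =
    \sum_(i < k.+1) (rearrange r)`_i.
  rewrite (big_ord_widen m (fun i => (rearrange r)`_i)) //.
  by apply: eq_bigr => l _; rewrite (tnth_nth 0).
by have := q_ge k.+1 le_km; rewrite sumrB subr_ge0 !nthE.
Qed.

Lemma majorizes_sum {R : realType} m (q p : m.-tuple R) :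
  majorizes q p -> \sum_(i < m) ((rearrange q)`_i - (rearrange p)`_i) = 0.
Proof.
move=> [eq_qp _]; have nthE (r : m.-tuple R) :
    \sum_(i < m) tnth (rearrange r) i = \sum_(i < m) (rearrange r)`_i.
  by apply: eq_bigr => i _; rewrite (tnth_nth 0).
by rewrite sumrB -!nthE eq_qp subrr.
Qed.

(** Here [s] plays the role of a monotone choice of subgradients of [g] on [D], so neither
    differentiability nor the shape of [g] enters. *)
Lemma karamata_of_slope {R : realType} m (q p : m.-tuple R) (D : set R)
    (g s : R -> R) :
    (forall i, D (tnth q i)) -> (forall i, D (tnth p i)) ->
    (forall x y, D x -> D y -> s x * (y - x) <= g y - g x) ->
    (forall x y, D x -> D y -> x <= y -> s x <= s y) ->
    majorizes q p ->
  \sum_(i < m) g (tnth p i) <= \sum_(i < m) g (tnth q i).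
Proof.
case: m q p => [|m] q p Dq Dp s_tangent s_homo maj; first by rewrite !big_ord0.
have Dsort (r : m.+1.-tuple R) : (forall i, D (tnth r i)) ->
    forall i, (i < m.+1)%N -> D (rearrange r)`_i.
  move=> Dr i lt_im; have : (rearrange r)`_i \in tval r.
    by rewrite -(mem_sort >=%R) mem_nth // size_sort size_tuple.
  by move=> /tnthP[j ->].
have nthE (r : m.+1.-tuple R) : \sum_(i < m.+1) g (tnth r i) =
    \sum_(i < m.+1) g (rearrange r)`_i.
  by rewrite -sum_rearrange; apply: eq_bigr => i _; rewrite (tnth_nth 0).
rewrite !nthE -subr_ge0 -sumrB.
pose w i := s (rearrange p)`_i.
pose d i := (rearrange q)`_i - (rearrange p)`_i.
apply: (@le_trans _ _ (\sum_(i < m.+1) w i * d i)); last first.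
  by apply: ler_sum => i _; apply: s_tangent; exact: Dsort.
apply: le_trans (abel_sum_ge w d m _ _).
(* Equal totals make the Abel lower bound zero. *)
- by rewrite majorizes_sum ?mulr0.
- move=> i lt_im; apply: s_homo.
  + exact: Dsort.
  + by apply: Dsort => //; exact: leqW.
  + by apply: rearrange_homo; rewrite leqnSn.
- by move=> k le_km; apply: majorizes_partial_sum => //; exact: leqW.
Qed.

Theorem theorem2p10 (R : realType) (n m : nat) (hn : (0 < n)%N) (hm : (0 < m)%N)
    (p p' : m.-tuple R)
    (hp : forall i : 'I_m, tnth p i \in `[0, 1])
    (hp' : forall i : 'I_m, tnth p' i \in `[0, 1])
    (hmaj : majorizes p p')
    (f : R -> R) (hf : convex_function (`[0, 1]%classic : set R^o) f) :
  \sum_(i < m) bernstein n f (tnth p' i) <= \sum_(i < m) bernstein n f (tnth p i).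
Proof.
case: n hn => // n _.
pose c i := f (i%:R / n.+1%:R).
have c_cvx i : (i < n)%N -> c i.+1 - c i <= c i.+2 - c i.+1.
  by move=> lt_in; apply: convex_function_nodes.
(* This is the derivative of [bernstein n.+1 f], which unfolds to the form of degree [n.+1] with
   coefficients [c]. *)
pose s x := n.+1%:R * bernstein_form (fun i => c i.+1 - c i) n x.
apply: (@karamata_of_slope _ _ _ _ `[0, 1]%classic (bernstein n.+1 f) s) => //.
- by move=> x y; rewrite /= !in_itv /=; exact: bernstein_form_tangent.
- move=> x y; rewrite /= !in_itv /= => /andP[x0 _] /andP[_ y1] xy.
  by rewrite ler_wpM2l ?ler0n // bernstein_form_nondecreasing.
Qed.
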